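(* Let $U=\{1,\dots,n\}$ with distance function $d$ and continuation probabilities $p_i\in[a,b]$ for all $i\in U$, where $0<a\le b<1$. Let $\tau$ be an integer with $2\le\tau\le n$. Then the B$\tau$I algorithm provides a $\frac{a^2(1-b)(1-b^{\tau-1})}{a^2+(\tau-1)b^{\tau+1}}$-approximation guarantee for MaxOHP. That is, for any ordering $O$ output by the algorithm, $$\mathcal{H}(O)\ \ge\ \frac{a^2(1-b)(1-b^{\tau-1})}{a^2+(\tau-1)b^{\tau+1}}\,\max_{O'}\mathcal{H}(O'),$$ the maximum being over all orderings $O'$ of $U$.
   Context: The distance function $d:U\times U\to\mathbb{R}_{\ge0}$ is symmetric with $d(i,i)=0$. For an ordering $O=(\pi(1),\dots,\pi(n))$ of $U$, let $O_k=(\pi(1),\dots,\pi(k))$ and $p_{O_k}=\prod_{t=1}^kp_{\pi(t)}$. The ordered Hamiltonian path objective is $\mathcal{H}(O)=\sum_{i=1}^{n-1}W_{O_i}\,d(\pi(i),\pi(i+1))$ with $W_{O_i}=\sum_{j=i+1}^np_{O_j}$. MaxOHP asks for an ordering of $U$ maximizing $\mathcal{H}$. The B$\tau$I algorithm (non-uniform case) chooses a sequence $O_\tau=(\pi(1),\dots,\pi(\tau))$ of $\tau$ distinct items maximizing $\tilde{\mathcal{H}}(O_\tau)=\sum_{i=1}^{\tau-1}\sum_{j=i+1}^{\tau}p_{O_j}\,d(\pi(i),\pi(i+1))$ over all sequences of $\tau$ distinct items of $U$, and then extends it to an ordering of all of $U$ by appending the remaining items in an arbitrary order. *)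

(* Defs.v *)
From mathcomp Require Import all_boot all_order all_algebra.
Set Implicit Arguments.
Unset Strict Implicit.
Unset Printing Implicit Defensive.
Import Order.TTheory GRing.Theory Num.Theory.
Local Open Scope ring_scope.

(* Sequences of distinct items are duplicate-free tuples; an ordering of the  *)
(* n items is a duplicate-free n-tuple.  Positions are numbered from 1.       *)

Definition distance (R : realFieldType) (n : nat) (d : 'I_n -> 'I_n -> R) :=
  [/\ forall i j, 0 <= d i j, forall i j, d i j = d j i & forall i, d i i = 0].

(* p_{O_k} *)
Definition prefix_prob (R : realFieldType) (n : nat) (p : 'I_n -> R)
    (O : seq 'I_n) (k : nat) : R :=
  \prod_(u <- take k O) p u.

(* d(pi(i), pi(i+1)) for 1 <= i < size O; the head of O only serves as the    *)
(* default value of nth and is irrelevant in that range.                      *)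
Definition step (R : realFieldType) (n : nat) (d : 'I_n -> 'I_n -> R)
    (O : seq 'I_n) (i : nat) : R :=
  if O is x0 :: _ then d (nth x0 O i.-1) (nth x0 O i) else 0.

(* W_{O_i} *)
Definition W (R : realFieldType) (n : nat) (p : 'I_n -> R)
    (O : seq 'I_n) (i : nat) : R :=
  \sum_(i.+1 <= j < n.+1) prefix_prob p O j.

Definition OHP (R : realFieldType) (n : nat) (d : 'I_n -> 'I_n -> R)
    (p : 'I_n -> R) (O : n.-tuple 'I_n) : R :=
  \sum_(1 <= i < n) W p O i * step d O i.

(* The maximum of OHP over all orderings. *)
Definition maxOHP (R : realFieldType) (n : nat) (d : 'I_n -> 'I_n -> R)
    (p : 'I_n -> R) : R :=
  OHP d p [arg max_(O > ord_tuple n | uniq O) OHP d p O]%O.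

(* The truncated objective H~(O_tau). *)
Definition truncOHP (R : realFieldType) (n : nat) (d : 'I_n -> 'I_n -> R)
    (p : 'I_n -> R) (tau : nat) (S : seq 'I_n) : R :=
  \sum_(1 <= i < tau) \sum_(i.+1 <= j < tau.+1) prefix_prob p S j * step d S i.

(* O is a possible output: an ordering whose first tau items maximize H~;     *)
(* ties and the order of the remaining items are resolved arbitrarily.        *)
Definition BtauI_output (R : realFieldType) (n : nat) (d : 'I_n -> 'I_n -> R)
    (p : 'I_n -> R) (tau : nat) (O : n.-tuple 'I_n) : Prop :=
  uniq O /\ forall S : tau.-tuple 'I_n, uniq S ->
    truncOHP d p tau S <= truncOHP d p tau (take tau O).

(* Main.v *)
Require Import Defs.
From mathcomp Require Import all_boot all_order all_algebra.
From mathcomp Require Import lra.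
Import Order.TTheory GRing.Theory Num.Theory.
Local Open Scope ring_scope.

(* Let M be the maximal truncated objective, P_k the prefix products of an    *)
(* arbitrary ordering and e_i its step lengths.  As the prefix products decay *)
(* at rate b, (1 - b) W_i <= P_{i+1}, so (1 - b) H is at most the sum of the  *)
(* P_{i+1} e_i.  The terms with i < tau are dominated by the truncated        *)
(* objective of the first tau items, hence by M.  A later term is at most     *)
(* b^(i+1) e_i, and a^2 e_i <= M because the two items at distance e_i may be *)
(* placed first in a sequence of tau items; these terms therefore contribute  *)
(* at most b^(tau+1) M / (a^2 (1 - b)).  Bernoulli's inequality               *)
(* 1 - b^(tau-1) <= (tau-1) (1 - b) yields the stated ratio.                  *)

(** Both objectives are compared with M. [truncOHP_le_OHP] gives M <= H for the output, while
    [OHP_le_of_truncOHP_le] bounds H of every ordering by M / (1 - b) + b^(tau+1) M / (a^2 (1 -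
    b)^2), using [OHP_le_first_prob], then [head_le_truncOHP] for the head and [step_rot] with
    [step_le_truncOHP] for the tail. [one_subX_le] trades this constant for the stated one. *)

(** Telescoping: decay gives (1 - b) f j <= f j - f (j+1). Decay is assumed only below n because
    prefix products stay constant past the end of a sequence. *)
Lemma geometric_decay_sum (R : realFieldType) (b : R) (f : nat -> R) (m n : nat) :
    (forall k, (m <= k)%N -> 0 <= f k) -> 0 <= b ->
    (forall k, (m <= k)%N -> (k.+1 < n)%N -> f k.+1 <= b * f k) ->
  (1 - b) * \sum_(m <= j < n) f j <= f m.
Proof.
move=> f_ge0 b_ge0 f_decay.
have [le_nm|lt_mn] := leqP n m; first by rewrite big_geq // mulr0 f_ge0.
move Dl: (n - m)%N => l.
elim: l m Dl lt_mn f_ge0 f_decay => [|l IHl] m Dl lt_mn f_ge0 f_decay.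
  by move: lt_mn; rewrite -subn_gt0 Dl.
have fm0 := f_ge0 m (leqnn m).
rewrite big_ltn //.
have [lt_m1n|le_nm1] := ltnP m.+1 n; last first.
  rewrite big_geq // addr0; nra.
have f1 := f_decay m (leqnn m) lt_m1n.
have := IHl m.+1 _ lt_m1n _ _; rewrite subnS Dl => /(_ erefl) IH.
have {}IH : (1 - b) * \sum_(m.+1 <= j < n) f j <= f m.+1.
  by apply: IH => k lt_mk; [exact/f_ge0/ltnW | exact/f_decay/ltnW].
rewrite mulrDr; lra.
Qed.

Lemma one_subX_le (R : realFieldType) (b : R) (k : nat) :
  0 <= b -> b <= 1 -> 1 - b ^+ k <= k%:R * (1 - b).
Proof.
move=> b_ge0 b_le1; elim: k => [|k IHk]; first by rewrite expr0 subrr mul0r.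
have bk_ge0 : 0 <= b ^+ k by rewrite exprn_ge0.
have bk_le1 : b ^+ k <= 1 by rewrite exprn_ile1.
rewrite exprS -natr1 mulrDl mul1r; nra.
Qed.

Section PrefixProducts.

Variables (R : realFieldType) (n : nat) (d : 'I_n -> 'I_n -> R).
Variables (p : 'I_n -> R) (a b : R).
Hypotheses (d_ge0 : forall i j, 0 <= d i j) (p_ge0 : forall i, 0 <= p i).
Hypotheses (p_ge : forall i, a <= p i) (p_le : forall i, p i <= b).
Hypotheses (a_ge0 : 0 <= a) (b_lt1 : b < 1).

Lemma step_ge0 (s : seq 'I_n) i : 0 <= step d s i.
Proof. by case: s => [|x s] //=; apply: d_ge0. Qed.

Lemma prefix_prob_ge0 (s : seq 'I_n) k : 0 <= prefix_prob p s k.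
Proof. by apply: prodr_ge0 => i _. Qed.

Lemma prefix_probS_le (s : seq 'I_n) k :
  (k < size s)%N -> prefix_prob p s k.+1 <= b * prefix_prob p s k.
Proof.
case: s => // x0 s lt_ks; rewrite /prefix_prob (take_nth x0) // -cats1.
by rewrite big_cat big_seq1 /= mulrC ler_wpM2r ?prefix_prob_ge0.
Qed.

Lemma prefix_prob_le_expn (s : seq 'I_n) k :
  0 <= b -> (k <= size s)%N -> prefix_prob p s k <= b ^+ k.
Proof.
move=> b_ge0; elim: k => [|k IHk] lt_ks.
  by rewrite /prefix_prob take0 big_nil expr0.
rewrite exprS (le_trans (prefix_probS_le _ _ lt_ks)) // ler_wpM2l //.
exact/IHk/ltnW.
Qed.

Lemma prefix_prob_take (s : seq 'I_n) m k :
  (k <= m)%N -> prefix_prob p (take m s) k = prefix_prob p s k.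
Proof. by move=> le_km; rewrite /prefix_prob take_takel. Qed.

Lemma step_take (s : seq 'I_n) m i :
  (i < m)%N -> step d (take m s) i = step d s i.
Proof.
case: s m => [|x s] [|m] // lt_im.
(* The truncation keeps the head [x], so both sides use the same [nth] default. *)
rewrite [take _ _]/= /step -[x :: take m s]/(take m.+1 (x :: s)).
by rewrite !nth_take // (leq_ltn_trans (leq_pred i)).
Qed.

Lemma truncOHP_take (s : seq 'I_n) m :
  truncOHP d p m (take m s) = truncOHP d p m s.
Proof.
rewrite /truncOHP; apply: eq_big_nat => i /andP[_ lt_im].
apply: eq_big_nat => j /andP[_ lt_jm].
by rewrite prefix_prob_take // step_take.
Qed.

(** Truncation only drops nonnegative terms: those with i >= m, and those with j > m inside each
    weight. *)
Lemma truncOHP_le_OHP (O : n.-tuple 'I_n) m :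
  (m <= n)%N -> truncOHP d p m O <= OHP d p O.
Proof.
move=> le_mn; rewrite /OHP; have [m0|m_gt0] := posnP m.
  rewrite m0 /truncOHP big_geq //; apply: sumr_ge0 => i _.
  rewrite mulr_ge0 ?step_ge0 // /W; apply: sumr_ge0 => j _.
  exact: prefix_prob_ge0.
rewrite (big_cat_nat m_gt0 le_mn) /= -[leLHS]addr0 lerD //; last first.
  apply: sumr_ge0 => i _; rewrite mulr_ge0 ?step_ge0 //.
  by apply: sumr_ge0 => j _; apply: prefix_prob_ge0.
rewrite /truncOHP; apply: ler_sum_nat => i /andP[_ lt_im].
rewrite -mulr_suml ler_wpM2r ?step_ge0 // /W.
have le1 : (i.+1 <= m.+1)%N by apply: ltnW.
rewrite [leRHS](big_cat_nat le1) //= lerDl.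
by apply: sumr_ge0 => j _; apply: prefix_prob_ge0.
Qed.

(** Only the term j = i+1 of each inner sum is kept. *)
Lemma head_le_truncOHP (s : seq 'I_n) m :
  \sum_(1 <= i < m) prefix_prob p s i.+1 * step d s i <= truncOHP d p m s.
Proof.
apply: ler_sum_nat => i /andP[_ lt_im].
rewrite [leRHS]big_ltn // lerDl; apply: sumr_ge0 => j _.
by rewrite mulr_ge0 ?step_ge0 ?prefix_prob_ge0.
Qed.

Lemma step_le_truncOHP (s : seq 'I_n) m :
  (2 <= m)%N -> (2 <= size s)%N -> a ^+ 2 * step d s 1 <= truncOHP d p m s.
Proof.
move=> m_gt1 s_gt1; apply: le_trans (head_le_truncOHP s m).
rewrite big_ltn //; apply: le_trans (_ : prefix_prob p s 2 * step d s 1 <= _).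
  rewrite ler_wpM2r ?step_ge0 //; case: s s_gt1 => [|x [|y s]] // _.
  rewrite /prefix_prob /= take0 big_cons big_seq1.
  by rewrite expr2 ler_pM.
rewrite lerDl; apply: sumr_ge0 => j _.
by rewrite mulr_ge0 ?step_ge0 ?prefix_prob_ge0.
Qed.

(** Rotation moves any consecutive pair to the front while keeping the items distinct, so
    [step_le_truncOHP] applies to every step of an ordering. *)
Lemma step_rot (s : seq 'I_n) i :
  (0 < i < size s)%N -> step d (rot i.-1 s) 1 = step d s i.
Proof.
case: i => // i /= lt_is; case: s lt_is => // x s lt_is.
by rewrite /rot (drop_nth x) ?(ltnW lt_is) // (drop_nth x).
Qed.

Lemma OHP_le_first_prob (O : n.-tuple 'I_n) :
  0 <= b ->
  (1 - b) * OHP d p O <= \sum_(1 <= i < n) prefix_prob p O i.+1 * step d O i.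
Proof.
move=> b_ge0; rewrite /OHP mulr_sumr; apply: ler_sum_nat => i /andP[_ lt_in].
rewrite mulrA ler_wpM2r ?step_ge0 // /W.
apply: geometric_decay_sum => // [k _ | k _ lt_kn].
  exact: prefix_prob_ge0.
by apply: prefix_probS_le; rewrite size_tuple.
Qed.

Lemma OHP_le_of_truncOHP_le (O : n.-tuple 'I_n) tau M :
    0 <= b -> (2 <= tau <= n)%N -> uniq O ->
    (forall s : seq 'I_n, uniq s -> (tau <= size s)%N ->
      truncOHP d p tau s <= M) ->
  a ^+ 2 * (1 - b) ^+ 2 * OHP d p O <= (a ^+ 2 * (1 - b) + b ^+ tau.+1) * M.
Proof.
move=> b_ge0 /andP[tau_gt1 le_tn] uO hM.
have n_gt1 : (1 < n)%N := leq_trans tau_gt1 le_tn.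
have sO : size O = n by rewrite size_tuple.
have := OHP_le_first_prob O b_ge0.
rewrite (big_cat_nat (ltnW tau_gt1) le_tn) /=.
have := le_trans (head_le_truncOHP O tau) (hM O uO _).
rewrite sO => /(_ le_tn).
set h := \sum_(1 <= i < tau) _; set t := \sum_(tau <= i < n) _ => hle Hle.
have stepM i : (0 < i < n)%N -> a ^+ 2 * step d O i <= M.
  move=> i_int; rewrite -step_rot ?sO //.
  apply: le_trans (hM (rot i.-1 O) _ _); rewrite ?rot_uniq ?size_rot ?sO //.
  by apply: step_le_truncOHP; rewrite ?size_rot ?sO.
have a2_ge0 : 0 <= a ^+ 2 by rewrite exprn_ge0.
have M_ge0 : 0 <= M.
  by apply: le_trans (stepM 1%N n_gt1); rewrite mulr_ge0 ?step_ge0.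
have tle : a ^+ 2 * t <= (\sum_(tau <= i < n) b ^+ i.+1) * M.
  rewrite mulr_sumr mulr_suml; apply: ler_sum_nat => i /andP[le_ti lt_in].
  rewrite mulrCA; apply: ler_pM.
  - exact: prefix_prob_ge0.
  - by rewrite mulr_ge0 ?step_ge0.
  - by rewrite prefix_prob_le_expn ?sO.
  by rewrite stepM // lt_in (leq_trans (ltnW tau_gt1)).
have geo : (1 - b) * \sum_(tau <= i < n) b ^+ i.+1 <= b ^+ tau.+1.
  apply: (@geometric_decay_sum _ b (fun i => b ^+ i.+1)) => // k _.
  by rewrite exprn_ge0.
have c_ge0 : 0 <= 1 - b by rewrite subr_ge0 ltW.
have Hle' : (1 - b) * OHP d p O <= M + t by lra.
have A : a ^+ 2 * (1 - b) * ((1 - b) * OHP d p O) <= a ^+ 2 * (1 - b) * (M + t).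
  exact: ler_wpM2l (mulr_ge0 a2_ge0 c_ge0) _ _ Hle'.
have B : (1 - b) * (a ^+ 2 * t) <= b ^+ tau.+1 * M.
  by apply: le_trans (ler_wpM2l c_ge0 tle) _; rewrite mulrA ler_wpM2r.
lra.
Qed.

End PrefixProducts.

Theorem theorem7p1 (R : realFieldType) (n : nat) (d : 'I_n -> 'I_n -> R)
    (p : 'I_n -> R) (a b : R) (tau : nat)
    (hd : distance d) (ha : 0 < a) (hab : a <= b) (hb : b < 1)
    (hp : forall i, a <= p i <= b) (htau : (2 <= tau <= n)%N)
    (O : n.-tuple 'I_n) (hO : BtauI_output d p tau O) :
  a ^+ 2 * (1 - b) * (1 - b ^+ tau.-1)
    / (a ^+ 2 + tau.-1%:R * b ^+ tau.+1) * maxOHP d p <= OHP d p O.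
Proof.
have [d_ge0 _ _] := hd; have [uO Omax] := hO; have /andP[_ le_tn] := htau.
have b_ge0 : 0 <= b by lra.
have p_ge i : a <= p i by have /andP[] := hp i.
have p_le i : p i <= b by have /andP[] := hp i.
have p_ge0 i : 0 <= p i by apply: le_trans (p_ge i); exact: ltW.
set M := truncOHP d p tau O.
(* The truncated objective reads only the first [tau] items, so optimality among [tau]-tuples
   extends to longer sequences, such as orderings and their rotations. *)
have hM (s : seq 'I_n) :
    uniq s -> (tau <= size s)%N -> truncOHP d p tau s <= M.
  move=> us le_ts; have sz : size (take tau s) == tau by rewrite size_takel.
  rewrite -truncOHP_take /M -[leRHS]truncOHP_take.
  by apply: (Omax (Tuple sz)); rewrite take_uniq.
have MO : M <= OHP d p O by exact: truncOHP_le_OHP.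
rewrite /maxOHP; case: arg_maxP => [|Q uQ _].
  by rewrite val_ord_tuple enum_uniq.
apply: le_trans MO.
have := OHP_le_of_truncOHP_le _ _ _ _ _ _ d_ge0 p_ge0 p_ge p_le (ltW ha) hb
  Q tau M b_ge0 htau uQ hM.
set H := OHP d p Q; set k := tau.-1 => main.
have a2_gt0 : 0 < a ^+ 2 by rewrite exprn_gt0.
have bt_ge0 : 0 <= b ^+ tau.+1 by rewrite exprn_ge0.
have bern := one_subX_le _ _ k b_ge0 (ltW hb).
have cbk_ge0 : 0 <= 1 - b ^+ k by rewrite subr_ge0 exprn_ile1 // ltW.
have den_gt0 : 0 < a ^+ 2 + k%:R * b ^+ tau.+1.
  by rewrite ltr_wpDr // mulr_ge0.
have c_gt0 : 0 < 1 - b by rewrite subr_gt0.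
have M_ge0 : 0 <= M.
  by apply: sumr_ge0 => i _; apply: sumr_ge0 => j _;
    rewrite mulr_ge0 ?prefix_prob_ge0 ?step_ge0.
(* The extra factor 1 - b matches the (1 - b)^2 in [main]; after scaling by 1 - b^k, [B] and [C]
   bound the two parts of its right-hand coefficient. *)
rewrite mulrAC ler_pdivrMr // -(ler_pM2l c_gt0).
have A := ler_wpM2l cbk_ge0 main.
have B : (1 - b ^+ k) * (a ^+ 2 * (1 - b)) <= a ^+ 2 * (1 - b).
  rewrite ler_piMl //; first by rewrite mulr_ge0 ?ltW.
  by rewrite gerBl exprn_ge0.
have C := ler_wpM2r bt_ge0 bern.
have D := ler_wpM2r M_ge0 (lerD B C).
lra.
Qed.
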